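(* Let $A$ be a finite-dimensional associative unital $\mathbb{C}$-algebra. The linear map $\Theta\colon\mathrm{Cyc}(\mathsf{proj}\text{-}A)\to\mathcal{S}(A)$, $\beta_\bullet\mapsto\beta_A\circ\mu$, is an isomorphism of vector spaces with inverse $\phi\mapsto\mathrm{tr}_\bullet^\phi$.
   Context: $\mathsf{proj}\text{-}A$ is the category of finitely generated projective right $A$-modules. For a $\mathbb{C}$-linear (essentially small) category $\mathcal{A}$, $\mathrm{Cyc}(\mathcal{A})$ is the vector space (componentwise operations) of families $\beta_\bullet=\{\beta_X\}_{X\in\mathcal{A}}$ of linear maps $\beta_X\colon\mathcal{A}(X,X)\to\mathbb{C}$ with $\beta_X(f\circ g)=\beta_Y(g\circ f)$ for all $X,Y\in\mathcal A$, $f\in\mathcal{A}(Y,X)$, $g\in\mathcal{A}(X,Y)$. $\mathcal{S}(A)=\{\phi\in\mathrm{Hom}_{\mathbb{C}}(A,\mathbb{C})\mid\phi(ab)=\phi(ba)\ \forall a,b\in A\}$. $\mu\colon A\to\mathrm{End}_A(A_A)$ is the bijection sending $a$ to left multiplication by $a$ on the regular right module $A_A$; $\beta_A$ is the component of $\beta_\bullet$ at $A_A$. Pseudo-trace: for $W\in\mathsf{proj}\text{-}A$ there are $u_1,\dots,u_m\in W$ and $\alpha_1,\dots,\alpha_m\in\mathrm{Hom}_A(W,A)$ with $w=\sum_iu_i\alpha_i(w)$ for all $w\in W$. For $\phi\in\mathcal{S}(A)$ the pseudo-trace is $\mathrm{tr}_W^\phi\colon\mathrm{End}_A(W)\to\mathbb{C}$,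 $\mathrm{tr}_W^\phi(f)=\sum_i\phi(\alpha_i(f(u_i)))$, which is independent of the choice of $(u_i,\alpha_i)$; $\mathrm{tr}_\bullet^\phi=\{\mathrm{tr}_W^\phi\}_{W\in\mathsf{proj}\text{-}A}$. *)

(* Defs.v *)
From HB Require Import structures.
From mathcomp Require Import all_boot all_order all_algebra.
From mathcomp Require Import falgebra.
From mathcomp Require Import boolp functions reals complex.

Set Implicit Arguments.
Unset Strict Implicit.
Unset Printing Implicit Defensive.

Import GRing.Theory.
Local Open Scope ring_scope.

(* A K-algebra is a unital associative ring with a central ring morphism
   k |-> k.1 from K.  Unlike [falgType], this allows the zero algebra (and
   [algType] cannot be relaxed, since it is built on [nzRingType]). *)
Record finDimAlg (K : fieldType) := FinDimAlg {
  alg_ring :> pzRingType;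
  alg_in : {rmorphism K -> alg_ring};
  alg_inC : forall (k : K) (a : alg_ring), alg_in k * a = a * alg_in k;
  alg_span : exists n (e : 'I_n -> alg_ring),
    forall a, exists c : 'I_n -> K, a = \sum_i alg_in (c i) * e i
}.
Arguments alg_in {K A} : rename.

Section OfFalgType.
Variables (K : fieldType) (A : falgType K).

Lemma in_algC (k : K) (a : A) : in_alg A k * a = a * in_alg A k.
Proof. by rewrite /= mulr_algl mulr_algr. Qed.

Lemma in_alg_span : exists n (e : 'I_n -> A),
  forall a, exists c : 'I_n -> K, a = \sum_i in_alg A (c i) * e i.
Proof.
exists (\dim {:A}), (fun i => (vbasis {:A})`_i) => a.
exists (fun i => coord (vbasis {:A}) i a).
rewrite {1}(coord_vbasis (memvf a)).
by apply: eq_bigr => i _; rewrite /= mulr_algl.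
Qed.

Definition finDimAlg_of_falgType : finDimAlg K := FinDimAlg in_algC in_alg_span.

End OfFalgType.

Definition mk_linear (R : pzRingType) (U V : lmodType R) (f : U -> V)
    (fl : linear f) : {linear U -> V} :=
  HB.pack_for {linear U -> V} f (GRing.isLinear.Build R U V *:%R f fl).

Lemma linear_ext (R : pzRingType) (U V : lmodType R) (f g : {linear U -> V}) :
  f =1 g -> f = g.
Proof.
case: f => f [[fD] [fZ]]; case: g => g [[gD] [gZ]] /= fg.
have {fg} E : f = g by apply: funext.
by case: _ / E in gD gZ *; rewrite (Prop_irrelevance fD gD) (Prop_irrelevance fZ gZ).
Qed.

(* Right A-modules are left modules over the opposite ring A^c: for w : W and
   a : A, the product w.a is [(a : A^c) *: w]. *)
Notation rmodType A := (lmodType (alg_ring A)^c).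

Definition finitely_generated (R : pzRingType) (W : lmodType R) : Prop :=
  exists n (u : 'I_n -> W), forall w, exists a : 'I_n -> R,
    w = \sum_i a i *: u i.

Definition projective (R : pzRingType) (W : lmodType R) : Prop :=
  forall (M N : lmodType R) (p : {linear M -> N}) (f : {linear W -> N}),
    (forall y, exists x, p x = y) ->
    exists g : {linear W -> M}, forall w, p (g w) = f w.

Record projmod (K : fieldType) (A : finDimAlg K) := ProjMod {
  projmod_sort :> rmodType A;
  projmod_fg : finitely_generated projmod_sort;
  projmod_proj : projective projmod_sort
}.

(* K-linear structure on Hom_A(U, V); the sum is the library's [f \+ g]. *)
Section HomScale.
Variables (K : fieldType) (A : finDimAlg K) (U V : rmodType A).

Definition hom_scale (k : K) (f : U -> V) : U -> V :=
  fun u => (alg_in k : (alg_ring A)^c) *: f u.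

Variables (k : K) (f : {linear U -> V}).

Lemma hom_scale_is_linear : linear (hom_scale k f).
Proof.
move=> a u v; rewrite /hom_scale linearP scalerDr !scalerA; congr (_ *: _ + _).
exact: (esym (alg_inC k (a : A))).
Qed.

HB.instance Definition _ :=
  GRing.isLinear.Build _ U V _ (hom_scale k f) hom_scale_is_linear.

End HomScale.

Section Cyc.
Variables (K : fieldType) (A : finDimAlg K).

Record cyc := Cyc {
  cyc_fun :> forall X : projmod A, {linear X -> X} -> K;
  cyc_linear : forall (X : projmod A) (k : K) (f g : {linear X -> X}),
    cyc_fun (hom_scale k f \+ g) = k * cyc_fun f + cyc_fun g;
  cyc_cyclic : forall (X Y : projmod A)
    (f : {linear Y -> X}) (g : {linear X -> Y}),
    cyc_fun (f \o g) = cyc_fun (g \o f)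
}.

(* [cyc] quantifies over all modules, so it lives in too large a universe to be
   an [lmodType]; its componentwise operations are given as plain functions. *)
Lemma cyc_add_linear (b c : cyc) (X : projmod A) k (f g : {linear X -> X}) :
  b X (hom_scale k f \+ g) + c X (hom_scale k f \+ g) =
  k * (b X f + c X f) + (b X g + c X g).
Proof. by rewrite !cyc_linear mulrDr addrACA. Qed.

Lemma cyc_add_cyclic (b c : cyc) (X Y : projmod A)
    (f : {linear Y -> X}) (g : {linear X -> Y}) :
  b X (f \o g) + c X (f \o g) = b Y (g \o f) + c Y (g \o f).
Proof. by congr (_ + _); apply: cyc_cyclic. Qed.

Definition cyc_add (b c : cyc) : cyc :=
  @Cyc (fun X f => b X f + c X f) (@cyc_add_linear b c) (@cyc_add_cyclic b c).

Lemma cyc_scale_linear a (b : cyc) (X : projmod A) k (f g : {linear X -> X}) :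
  a * b X (hom_scale k f \+ g) = k * (a * b X f) + a * b X g.
Proof. by rewrite cyc_linear mulrDr mulrCA. Qed.

Lemma cyc_scale_cyclic a (b : cyc) (X Y : projmod A)
    (f : {linear Y -> X}) (g : {linear X -> Y}) :
  a * b X (f \o g) = a * b Y (g \o f).
Proof. by congr (_ * _); apply: cyc_cyclic. Qed.

Definition cyc_scale (a : K) (b : cyc) : cyc :=
  @Cyc (fun X f => a * b X f) (@cyc_scale_linear a b) (@cyc_scale_cyclic a b).

End Cyc.

Section SymForm.
Variables (K : fieldType) (A : finDimAlg K).

Definition is_symform (phi : A -> K^o) : Prop :=
  (forall k a b, phi (alg_in k * a + b) = k * phi a + phi b) /\
  (forall a b, phi (a * b) = phi (b * a)).

Definition symform_pred : {pred A -> K^o} := fun phi => `[< is_symform phi >].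

Lemma symform_submod : submod_closed symform_pred.
Proof.
split=> [|k f g /asboolP[fl fC] /asboolP[gl gC]]; apply/asboolP.
  by split=> [k a b|//]; rewrite /= mulr0 addr0.
split=> [l a b|a b].
  change (k * f (alg_in l * a + b) + g (alg_in l * a + b) =
          l * (k * f a + g a) + (k * f b + g b)).
  by rewrite fl gl !mulrDr addrACA (mulrCA k l).
change (k * f (a * b) + g (a * b) = k * f (b * a) + g (b * a)).
by rewrite fC gC.
Qed.

HB.instance Definition _ :=
  GRing.isSubmodClosed.Build K (A -> K^o) symform_pred symform_submod.

Record symform := SymForm {
  symform_fun :> A -> K^o;
  symform_funP : symform_fun \in symform_pred
}.

HB.instance Definition _ := [isSub for symform_fun].
HB.instance Definition _ := [Choice of symform by <:].
HB.instance Definition _ := [SubChoice_isSubLmodule of symform by <:].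

End SymForm.

Section Theta.
Variables (K : fieldType) (A : finDimAlg K).

(* In [regmod], [(a : A^c) *: x] is x * a computed in A. *)
Definition regmod : rmodType A := ((alg_ring A)^c)^o.

Lemma regmod_fg : finitely_generated regmod.
Proof.
exists 1%N, (fun=> 1) => w; exists (fun=> w).
by rewrite big_ord1 /GRing.scale /= mulr1.
Qed.

Lemma regmod_projective : projective regmod.
Proof.
move=> M N p f /(_ (f 1))[x px].
have gl : linear (fun w : regmod => (w : (alg_ring A)^c) *: x).
  by move=> a u v; rewrite scalerDl scalerA.
exists (mk_linear gl) => w /=.
by rewrite linearZ px -linearZ /=; congr (f _); rewrite /GRing.scale /= mulr1.
Qed.

Definition regproj : projmod A := ProjMod regmod_fg regmod_projective.

Definition lmul_fun (a : A) : regproj -> regproj := fun x => a * (x : A).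

Lemma lmul_is_linear a : linear (lmul_fun a).
Proof. by move=> b x y; rewrite /lmul_fun mulrDr [a * _]mulrA. Qed.

HB.instance Definition _ a :=
  GRing.isLinear.Build _ regproj regproj _ (lmul_fun a) (lmul_is_linear a).

Definition lmul (a : A) : {linear regproj -> regproj} := lmul_fun a.

Lemma Theta_subproof (b : cyc A) :
  ((fun a => b regproj (lmul a)) : A -> K^o) \in @symform_pred K A.
Proof.
apply/asboolP; split=> [k x y|x y].
  rewrite -cyc_linear; congr (b _ _); apply: linear_ext => z.
  by rewrite /= /lmul_fun mulrDl -mulrA alg_inC.
have E u v : lmul (u * v) = lmul u \o lmul v :> {linear regproj -> regproj}.
  by apply: linear_ext => z; rewrite /= /lmul_fun mulrA.
by rewrite !E cyc_cyclic.
Qed.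

Definition Theta (b : cyc A) : symform A := SymForm (Theta_subproof b).

End Theta.

Section DualBasis.
Variables (K : fieldType) (A : finDimAlg K).

Record dual_basis (W : rmodType A) := DualBasis {
  db_size : nat;
  db_elt : 'I_db_size -> W;
  db_form : 'I_db_size -> {linear W -> regmod A};
  dual_basisP : forall w,
    w = \sum_i (db_form i w : (alg_ring A)^c) *: db_elt i
}.

End DualBasis.
Arguments db_elt {K A W}.
Arguments db_form {K A W}.

Section PseudoTrace.
Variables (K : fieldType) (A : finDimAlg K).

Lemma dual_basis_exists (W : projmod A) : exists _ : dual_basis W, True.
Proof.
have [n [u uP]] := projmod_fg W.
pose R := (alg_ring A)^c.
pose p (v : 'rV[R]_n) : W := \sum_i v 0 i *: u i.
have pl : linear p.
  move=> a x y; rewrite /p scaler_sumr -big_split; apply: eq_bigr => i _.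
  by rewrite !mxE scalerDl scalerA.
have [|g gP] := @projmod_proj _ _ W _ _ (mk_linear pl) idfun.
  by move=> y; have [a ->] := uP y; exists (\row_i a i);
     apply: eq_bigr => i _; rewrite mxE.
have al i : linear (fun w : W => g w 0 i : regmod A).
  by move=> a x y; rewrite linearP !mxE.
have uP' w : w = \sum_i (mk_linear (al i) w : R) *: u i by rewrite -[LHS]gP.
by exists (DualBasis uP').
Qed.

Definition ptrace_of (phi : symform A) (W : rmodType A) (d : dual_basis W)
    (f : {linear W -> W}) : K :=
  \sum_i phi (db_form d i (f (db_elt d i))).

(* The choice of dual basis is immaterial: see [ptraceE]. *)
Definition ptrace (phi : symform A) (W : projmod A) (f : {linear W -> W}) : K :=
  ptrace_of phi (projT1 (cid (dual_basis_exists W))) f.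

Lemma symform_sum (phi : symform A) I (r : seq I) (F : I -> A) :
  phi (\sum_(i <- r) F i) = \sum_(i <- r) phi (F i).
Proof.
have /asboolP[pl _] := symform_funP phi.
have p0 : phi 0 = 0.
  by have := pl (-1) 0 0; rewrite mulr0 addr0 mulN1r addNr.
apply: (big_morph phi _ p0) => x y.
by have := pl 1 x y; rewrite rmorph1 !mul1r.
Qed.

Lemma ptrace_of_indep (phi : symform A) (W : rmodType A) (d e : dual_basis W)
    (f : {linear W -> W}) :
  ptrace_of phi d f = ptrace_of phi e f.
Proof.
have /asboolP[_ pC] := symform_funP phi.
rewrite /ptrace_of.
transitivity (\sum_i \sum_j phi ((db_form d i (db_elt e j) : A)
                                * (db_form e j (f (db_elt d i)) : A))).
  apply: eq_bigr => i _.
  rewrite {1}(dual_basisP e (f _)) linear_sum symform_sum.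
  by apply: eq_bigr => j _; rewrite linearZ.
rewrite exchange_big /=; apply: eq_bigr => j _.
rewrite {2}(dual_basisP d (db_elt e j)) !linear_sum symform_sum.
by apply: eq_bigr => i _; rewrite pC !linearZ.
Qed.

Lemma ptraceE (phi : symform A) (W : projmod A) (d : dual_basis W)
    (f : {linear W -> W}) :
  ptrace phi f = ptrace_of phi d f.
Proof. exact: ptrace_of_indep. Qed.

End PseudoTrace.

(* Main.v *)
Require Import Defs.
From HB Require Import structures.
From mathcomp Require Import all_boot all_order all_algebra.
From mathcomp Require Import boolp functions reals complex.
Import GRing.Theory.
Local Open Scope ring_scope.

(** For a dual basis (u_i, alpha_i) of W, let c_i : A -> W be the map
    a |-> u_i a, so that the identity of W is the sum of the c_i \o alpha_i.
    Hence f is the sum of the f \o c_i \o alpha_i, and a cyclic family beta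
    satisfies
      beta_W(f) = sum_i beta_A(alpha_i \o f \o c_i).
    Since alpha_i \o f \o c_i is left multiplication by alpha_i(f(u_i)), this
    is the pseudo-trace of f for the form beta_A \o mu.  Conversely the
    pseudo-trace of left multiplication by a, computed in the dual basis
    (1, id) of A, is phi(a). *)

Section PseudoTraceTheory.
Set Implicit Arguments.
Unset Strict Implicit.
Variables (K : fieldType) (A : finDimAlg K).

Lemma ptrace_linear (phi : symform A) (W : projmod A) (k : K)
    (f g : {linear W -> W}) :
  ptrace phi (hom_scale k f \+ g) = k * ptrace phi f + ptrace phi g.
Proof.
have /asboolP[phi_lin _] := symform_funP phi.
rewrite /ptrace /ptrace_of mulr_sumr -big_split; apply: eq_bigr => i _ /=.
rewrite linearD linearZ -phi_lin; congr (phi (_ + _)).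
(* [hom_scale] multiplies on the right in [A]; centrality of scalars moves k to the left. *)
exact: (esym (alg_inC _ _)).
Qed.

(** Expanding g(u_i) in the dual basis of Y gives a double sum where f and g have matching roles, so
    cyclicity of the pseudo-trace reduces to exchanging the sums and phi(xy) = phi(yx). *)
Lemma ptrace_of_comp (phi : symform A) (X Y : rmodType A)
    (d : dual_basis X) (e : dual_basis Y)
    (f : {linear Y -> X}) (g : {linear X -> Y}) :
  ptrace_of phi d (f \o g) =
  \sum_i \sum_j phi ((db_form d i (f (db_elt e j)) : A)
                     * (db_form e j (g (db_elt d i)) : A)).
Proof.
apply: eq_bigr => i _ /=.
rewrite {1}(dual_basisP e (g _)) !linear_sum symform_sum.
by apply: eq_bigr => j _; rewrite !linearZ.
Qed.

Lemma ptrace_cyclic (phi : symform A) (X Y : projmod A)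
    (f : {linear Y -> X}) (g : {linear X -> Y}) :
  ptrace phi (f \o g) = ptrace phi (g \o f).
Proof.
have /asboolP[_ phiC] := symform_funP phi.
have [d _] := dual_basis_exists X; have [e _] := dual_basis_exists Y.
rewrite (ptraceE _ d) (ptraceE _ e) (ptrace_of_comp _ d e) (ptrace_of_comp _ e d).
rewrite exchange_big; apply: eq_bigr => j _; apply: eq_bigr => i _.
exact: phiC.
Qed.

Definition ptrace_cyc (phi : symform A) : cyc A :=
  @Cyc K A (@ptrace K A phi) (@ptrace_linear phi) (@ptrace_cyclic phi).

Lemma cyc_ext (b c : cyc A) :
  (forall (X : projmod A) (f : {linear X -> X}), b X f = c X f) -> b = c.
Proof.
case: b => b bl bC; case: c => c cl cC /= bc.
have {bc} E : b = c by apply: functional_extensionality_dep => X; apply: funext.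
case: _ / E in cl cC *.
by rewrite (Prop_irrelevance bl cl) (Prop_irrelevance bC cC).
Qed.

(** Induction from two-term linearity; the hypothesis is pointwise, so that the statement forms no
    sum of morphisms. *)
Lemma cyc_sum (b : cyc A) (X : projmod A) (I : Type) (r : seq I)
    (F : I -> {linear X -> X}) (h : {linear X -> X}) :
  (forall x, h x = \sum_(i <- r) F i x) -> b X h = \sum_(i <- r) b X (F i).
Proof.
elim: r h => [|i r IHr] h hE.
  (* Here h = 0, so h = -h + h and linearity gives b(h) = -b(h) + b(h) = 0. *)
  have {1}-> : h = (hom_scale (-1) h \+ h : {linear X -> X}).
    by apply: linear_ext => x; rewrite /= /hom_scale hE big_nil scaler0 addr0.
  by rewrite cyc_linear mulN1r addNr big_nil.
have Sl : linear (fun x : X => \sum_(j <- r) F j x).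
  move=> a x y; rewrite scaler_sumr -big_split.
  by apply: eq_bigr => j _; rewrite linearP.
have -> : h = (hom_scale 1 (F i) \+ mk_linear Sl : {linear X -> X}).
  by apply: linear_ext => x; rewrite /= /hom_scale hE big_cons rmorph1 scale1r.
by rewrite cyc_linear mul1r big_cons (IHr (mk_linear Sl)).
Qed.

Lemma elt_map_is_linear (W : rmodType A) (u : W) :
  linear (fun a : regproj A => (a : (alg_ring A)^c) *: u).
Proof. by move=> a x y; rewrite scalerDl scalerA. Qed.

Lemma ptrace_Theta (b : cyc A) (W : projmod A) (f : {linear W -> W}) :
  ptrace (Theta b) f = b W f.
Proof.
have [d _] := dual_basis_exists W.
pose c i : {linear regproj A -> W} := mk_linear (@elt_map_is_linear W (db_elt d i)).
pose al i : {linear W -> regproj A} := db_form d i.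
rewrite (ptraceE _ d).
rewrite (@cyc_sum b W _ (index_enum 'I_(db_size d))
  (fun i => (f \o c i) \o al i : {linear W -> W}) f); last first.
  by move=> w; rewrite {1}(dual_basisP d w) linear_sum.
(* Cyclicity carries the i-th term to A, where both maps send a to alpha_i(f(u_i)) a by
   A-linearity. *)
apply: eq_bigr => i _; rewrite cyc_cyclic; congr (b _ _).
apply: linear_ext => a.
by rewrite /= !linearZ.
Qed.

Lemma regproj_dual_basisP (w : regproj A) :
  w = \sum_(i < 1) ((idfun : {linear regmod A -> regmod A}) w : (alg_ring A)^c)
        *: (1 : regmod A).
Proof. by rewrite big_ord1 /GRing.scale /= mulr1. Qed.

Lemma ptrace_lmul (phi : symform A) (a : A) : ptrace phi (lmul a) = phi a.
Proof.
rewrite (ptraceE _ (DualBasis regproj_dual_basisP)) /ptrace_of big_ord1.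
by congr (phi _); apply: (mulr1 (a : A)).
Qed.

Lemma ThetaK : cancel (@Theta K A) ptrace_cyc.
Proof. by move=> b; apply: cyc_ext => X f; apply: ptrace_Theta. Qed.

Lemma ptrace_cycK : cancel ptrace_cyc (@Theta K A).
Proof. by move=> phi; apply/val_inj/funext => a; apply: ptrace_lmul. Qed.

End PseudoTraceTheory.

Theorem lemma4p16 (R : realType) (A : finDimAlg R[i]) :
  (forall (k : R[i]) (b c : cyc A),
     Theta (cyc_add (cyc_scale k b) c) = k *: Theta b + Theta c) /\
  (exists tr : symform A -> cyc A,
     (forall (phi : symform A) (W : projmod A) (f : {linear W -> W}),
        tr phi W f = ptrace phi f) /\
     cancel (@Theta _ A) tr /\ cancel tr (@Theta _ A)).
Proof.
(* The operations on both sides are componentwise, so linearity holds by computation. *)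
split=> [k b c|]; first exact/val_inj.
exists (@ptrace_cyc _ A); split=> //.
by split; [apply: ThetaK | apply: ptrace_cycK].
Qed.
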